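(* Let $\delta$ be a real number. If $\delta$ is quasi-admissible, then every real $\hat{\delta} < \delta$ is admissible. Moreover, if $\delta$ is quasi-admissible by quasi-stable polynomials $x,y$ of degree at most $n$, then every real $\hat{\delta}<\delta$ is admissible by stable polynomials $\hat{x},\hat{y}$ of degree at most $n$.
   Context: A polynomial $p(s)\in\mathbb{R}[s]$ is stable if every complex root $t$ of $p$ satisfies $\mathrm{Re}(t)<0$, and quasi-stable if every complex root $t$ of $p$ satisfies $\mathrm{Re}(t)\le 0$. (Nonzero constants are stable; the zero polynomial is neither stable nor quasi-stable.) Let $H$ be the set of stable polynomials in $\mathbb{R}[s]$ and $\overline{H}$ the set of quasi-stable polynomials in $\mathbb{R}[s]$. A real number $\delta$ is admissible by $x,y$ if $x,y\in H$, $\deg(x)\ge\deg(y)$, and $(s^2-2\delta s+1)x(s)+(s^2-1)y(s)\in H$; $\delta$ is admissible if it is admissible by some such $x,y$. A real number $\delta$ is quasi-admissible by $x,y$ if $x,y\in\overline{H}$, $\deg(x)\ge\deg(y)$, and $(s^2-2\delta s+1)x(s)+(s^2-1)y(s)\in\overline{H}$; $\delta$ is quasi-admissible if it is quasi-admissible by some such $x,y$. *)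

(* Defs.v *)
From mathcomp Require Import all_boot all_order all_algebra.
From mathcomp Require Import reals.
From mathcomp Require Import complex.

Set Implicit Arguments.
Unset Strict Implicit.
Unset Printing Implicit Defensive.

Import Order.TTheory GRing.Theory Num.Theory.

Local Open Scope ring_scope.

(* Every complex number is a root of 0, so the zero polynomial is neither
   stable nor quasi-stable; nonzero constants are vacuously both. *)
Definition stable (R : realType) (p : {poly R}) : Prop :=
  forall t : R[i], root (map_poly (real_complex R) p) t -> complex.Re t < 0.

Definition quasi_stable (R : realType) (p : {poly R}) : Prop :=
  forall t : R[i], root (map_poly (real_complex R) p) t -> complex.Re t <= 0.

Definition closed_loop (R : realType) (delta : R) (x y : {poly R}) : {poly R} :=
  ('X^2 - (2 * delta) *: 'X + 1) * x + ('X^2 - 1) * y.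

(* [size p] is [deg p + 1] for nonzero [p], and [x], [y] are nonzero here. *)
Definition admissible_by (R : realType) (delta : R) (x y : {poly R}) : Prop :=
  [/\ stable x, stable y, (size y <= size x)%N
    & stable (closed_loop delta x y)].

Definition admissible (R : realType) (delta : R) : Prop :=
  exists x y : {poly R}, admissible_by delta x y.

Definition quasi_admissible_by (R : realType) (delta : R) (x y : {poly R})
    : Prop :=
  [/\ quasi_stable x, quasi_stable y, (size y <= size x)%N
    & quasi_stable (closed_loop delta x y)].

Definition quasi_admissible (R : realType) (delta : R) : Prop :=
  exists x y : {poly R}, quasi_admissible_by delta x y.

(* Main.v *)
Require Import Defs.
From mathcomp Require Import all_boot all_order all_algebra.
From mathcomp Require Import reals.
From mathcomp Require Import complex polyrcf ring lra.

Import Order.TTheory GRing.Theory Num.Theory.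

Local Open Scope ring_scope.

(** A real number [delta >= 1] is never quasi-admissible: the roots
    [s1 <= 1 <= s2] of [s^2 - 2 delta s + 1] are positive, the closed loop
    takes the values [(si^2 - 1) y(si)] there, and these cannot have the same
    strict sign although a quasi-stable polynomial keeps its sign on the
    positive reals ([closed_loop_lt1]).  A number [delta' < 0] is admissible by
    constants ([admissible_neg]).  What is left is [0 <= delta' < delta < 1].

    For [0 < a < 1] the Moebius map [m s = (s + a) / (a s + 1)] sends the
    closed right half-plane, infinity included, into the open one.  Hence, for
    [p] quasi-stable of degree at most [d], the polynomial
    [(a s + 1)^d p(m s)] is stable ([stable_moebius]) and has degree exactly
    [d] ([size_moebius]); with [d = deg x] this preserves the degree
    conditions.  In the coordinate [w = (s - 1) / (s + 1)] the map [m] is the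
    contraction [w |-> r w] of the unit disc with [r = (1 - a) / (1 + a)].
    It fixes the points 1 and -1 and preserves
    the pencil of quadratics involved: up to the factor [(a s + 1)^2],
    - [s^2 - 1] pulls back to [(1 - a^2) (s^2 - 1)], and
    - [s^2 - 2 delta s + 1] pulls back to
      [(1 + a^2 - 2 delta a) (s^2 - 2 delta' s + 1)], where
      [delta' (1 + a^2 - 2 delta a) = delta (1 + a^2) - 2 a].
    Substituting [m s] in the closed loop of [x, y] at [delta] thus gives a
    closed loop at [delta'], with the constants absorbed in the new [x, y]
    ([stable_closed_loop_moebius]).
    As [a] decreases from 1 to 0 the number [delta'] increases from -1 to
    [delta], so every [delta'] in between is reached ([exists_moebius]). *)

(** * Values of quasi-stable polynomials *)

Lemma quasi_stable_neq0 {R : realType} (p : {poly R}) (t : R[i]) :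
  quasi_stable p -> 0 < complex.Re t ->
  (map_poly (real_complex R) p).[t] != 0.
Proof.
by move=> qp t_gt0; apply/negP => /qp; rewrite leNgt t_gt0.
Qed.

Lemma quasi_stable_neq0_real {R : realType} (p : {poly R}) (t : R) :
  quasi_stable p -> 0 < t -> p.[t] != 0.
Proof.
move=> qp t_gt0.
have := quasi_stable_neq0 p (real_complex R t) qp t_gt0.
by rewrite horner_map /= fmorph_eq0.
Qed.

Lemma quasi_stable_same_sign {R : realType} (p : {poly R}) (a b : R) :
  quasi_stable p -> 0 < a -> a <= b -> 0 < p.[a] * p.[b].
Proof.
move=> qp a_gt0 le_ab; rewrite lt_neqAle eq_sym mulf_neq0 /=; last 2 first.
- exact: quasi_stable_neq0_real.
- by apply: quasi_stable_neq0_real => //; apply: lt_le_trans le_ab.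
rewrite leNgt; apply/negP => /(poly_ivtoo le_ab) [c].
rewrite inE /= => /andP[lt_ac _] /rootP pc0.
have := quasi_stable_neq0_real p c qp (lt_trans a_gt0 lt_ac).
by rewrite pc0 eqxx.
Qed.

Lemma horner_closed_loop {R : realType} (delta : R) (x y : {poly R}) (s : R) :
  (closed_loop delta x y).[s] =
  (s ^+ 2 - 2 * delta * s + 1) * x.[s] + (s ^+ 2 - 1) * y.[s].
Proof. by rewrite /closed_loop !hornerE; ring. Qed.

Lemma horner_map_closed_loop {R : realType} (delta : R) (x y : {poly R})
    (s : R[i]) (f := real_complex R) :
  (map_poly f (closed_loop delta x y)).[s] =
  (s ^+ 2 - 2 * f delta * s + 1) * (map_poly f x).[s]
  + (s ^+ 2 - 1) * (map_poly f y).[s].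
Proof.
rewrite /closed_loop /f !(rmorphD, rmorphM, rmorphB, rmorphN, rmorph1) /=.
rewrite !map_polyZ !map_polyX !hornerE /= rmorphM rmorph_nat.
by ring.
Qed.

(** * The ranges of delta without transformation *)

(** The witnesses are the roots [delta - q] and [delta + q] of
    [s^2 - 2 delta s + 1], with product 1: there only the term in [y] is left,
    and its factor [s^2 - 1] changes sign between them, or vanishes when
    [delta = 1]. *)
Lemma closed_loop_lt1 {R : realType} (delta : R) (x y : {poly R}) :
  quasi_stable y -> quasi_stable (closed_loop delta x y) -> delta < 1.
Proof.
move=> qy qz; rewrite ltNge; apply/negP => delta_ge1.
pose q := Num.sqrt (delta ^+ 2 - 1).
have q2 : q ^+ 2 = delta ^+ 2 - 1 by rewrite sqr_sqrtr //; nra.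
have q_ge0 : 0 <= q by apply: sqrtr_ge0.
have q_lt : q < delta by nra.
have s1_gt0 : 0 < delta - q by lra.
have le_s12 : delta - q <= delta + q by lra.
have zz := quasi_stable_same_sign _ _ _ qz s1_gt0 le_s12.
have yy := quasi_stable_same_sign _ _ _ qy s1_gt0 le_s12.
move: zz; rewrite !horner_closed_loop.
have -> : (delta - q) ^+ 2 - 2 * delta * (delta - q) + 1 = 0.
  by transitivity (q ^+ 2 - (delta ^+ 2 - 1)); [ring | rewrite q2 subrr].
have -> : (delta + q) ^+ 2 - 2 * delta * (delta + q) + 1 = 0.
  by transitivity (q ^+ 2 - (delta ^+ 2 - 1)); [ring | rewrite q2 subrr].
rewrite !mul0r !add0r mulrACA pmulr_lgt0 //.
(* Since [q^2 = delta^2 - 1], this product is [4 - 4 delta^2 <= 0]. *)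
have -> : ((delta - q) ^+ 2 - 1) * ((delta + q) ^+ 2 - 1)
          = (delta ^+ 2 - q ^+ 2) ^+ 2 - 2 * (delta ^+ 2 + q ^+ 2) + 1.
  by ring.
by rewrite q2; nra.
Qed.

Lemma stable_polyC {R : realType} (c : R) : c != 0 -> stable c%:P.
Proof.
by move=> c0 t; rewrite map_polyC rootC /= fmorph_eq0 (negPf c0).
Qed.

Lemma admissible_neg {R : realType} (delta : R) :
  delta < 0 -> admissible_by delta 1 (2^-1)%:P.
Proof.
move=> delta_lt0; split.
- by apply: stable_polyC; apply: oner_neq0.
- by apply: stable_polyC; rewrite invr_eq0 pnatr_eq0.
- by rewrite size_poly1 size_polyC; case: (_ != _).
(* The closed loop is [(3 s^2 - 4 delta s + 1) / 2]. *)
move=> [p q] /rootP; rewrite horner_map_closed_loop rmorph1 hornerC.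
rewrite map_polyC hornerC /= => E.
rewrite ltNge; apply/negP => p_ge0.
have {E} [re im] : 3 * (p ^+ 2 - q ^+ 2) - 4 * delta * p + 1 = 0
           /\ (3 * p - 2 * delta) * q = 0.
  have E2 : 2 * 1 = 2 :> R by rewrite mulr1.
  have h : 2 * 2^-1 = 1 :> R by rewrite mulfV // pnatr_eq0.
  move: E; rewrite !expr2 /=; simpc.
  case=> /= E1 E3; split; nra.
have k_gt0 : 0 < 3 * p - 2 * delta by lra.
have q0 : q = 0 by move/eqP: im; rewrite mulf_eq0 gt_eqF //= => /eqP.
by move: re; rewrite q0; nra.
Qed.

(** * The Moebius substitution *)

(** The polynomial [(a s + 1)^d p((s + a) / (a s + 1))]. *)
Definition moebius {R : realType} (d : nat) (a : R) (p : {poly R}) : {poly R} :=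
  \sum_(i < d.+1) p`_i *: (('X + a%:P) ^+ i * (a *: 'X + 1) ^+ (d - i)).

Lemma horner_moebius {R : realType} {d : nat} {a : R} {p : {poly R}}
    {s : R[i]} (f := real_complex R) :
  (size p <= d.+1)%N -> f a * s + 1 != 0 ->
  (map_poly f (moebius d a p)).[s] =
  (f a * s + 1) ^+ d * (map_poly f p).[(s + f a) / (f a * s + 1)].
Proof.
move=> sp den0.
rewrite (@horner_coef_wide _ d.+1 (map_poly f p)); last first.
  by rewrite size_map_poly.
rewrite /moebius rmorph_sum horner_sum mulr_sumr; apply: eq_bigr => i _.
rewrite /f /= map_polyZ rmorphM !rmorphXn !rmorphD /= map_polyZ !map_polyX.
rewrite map_polyC rmorph1 coef_map !hornerE /= -/f.
have -> : (f a * s + 1) ^+ d = (f a * s + 1) ^+ i * (f a * s + 1) ^+ (d - i).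
  by rewrite -exprD subnKC // -ltnS.
by rewrite expr_div_n; field; rewrite expf_neq0.
Qed.

(** The degree does not drop, even when [deg p < d], because infinity is sent
    to the positive real [a^-1], which is not a root of [p]. *)
Lemma size_moebius {R : realType} {d : nat} {a : R} {p : {poly R}} :
  0 < a -> quasi_stable p -> (size p <= d.+1)%N ->
  size (moebius d a p) = d.+1.
Proof.
move=> a_gt0 qp sp; have a_neq0 : a != 0 by rewrite gt_eqF.
pose M i : {poly R} := ('X + a%:P) ^+ i * ('X + a^-1%:P) ^+ (d - i).
have monM i : M i \is monic by rewrite monicMr ?monic_exp ?monicXaddC.
have sizeM (i : 'I_d.+1) : size (M i) = d.+1.
  have szX (c : R) k : size (('X + c%:P) ^+ k) = k.+1.
    by rewrite -[c]opprK polyCN size_exp_XsubC.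
  rewrite /M size_monicM; [|by rewrite monic_exp ?monicXaddC|]; last first.
    by rewrite -size_poly_eq0 szX.
  by rewrite !szX addnS /= addSn subnKC // -ltnS.
have coefM (i : 'I_d.+1) : (M i)`_d = 1.
  by move/monicP: (monM i); rewrite lead_coefE sizeM.
have E : moebius d a p = \sum_(i < d.+1) (p`_i * a ^+ (d - i)) *: M i.
  apply: eq_bigr => i _.
  have -> : a *: 'X + 1 = a *: ('X + a^-1%:P) :> {poly R}.
    by rewrite scalerDr -[_ *: _%:P]mul_polyC -polyCM mulfV.
  by rewrite exprZn -scalerAr scalerA.
(* Up to [a^d], the coefficient of degree [d] is the value of [p] at [a^-1],
   the image of infinity. *)
have lead : (moebius d a p)`_d = a ^+ d * p.[a^-1].
  rewrite E coef_sum (horner_coef_wide _ sp) mulr_sumr; apply: eq_bigr => i _.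
  rewrite coefZ coefM mulr1 mulrCA exprVn; congr (_ * _).
  by rewrite expfB_cond // (negPf a_neq0) add0n -ltnS.
apply/eqP; rewrite eqn_leq; apply/andP; split.
  rewrite E; apply: (leq_trans (size_sum _ _ _)); apply/bigmax_leqP => i _.
  by rewrite (leq_trans (size_scale_leq _ _)) // sizeM.
rewrite ltnNge; apply/negP => /(nth_default 0); rewrite lead; apply/eqP.
by rewrite mulf_neq0 ?expf_neq0 ?quasi_stable_neq0_real ?invr_gt0.
Qed.

Lemma moebius_den_neq0 {R : realType} {a : R} {s : R[i]} :
  0 < a -> 0 <= complex.Re s -> real_complex R a * s + 1 != 0.
Proof.
case: s => u v a_gt0 /= u_ge0; apply/eqP; simpc => -[re _].
by nra.
Qed.

(** With [s = u + i v], multiplying numerator and denominator by the conjugate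
    of the latter gives the real part
    [((u + a) (a u + 1) + a v^2) / |a s + 1|^2]. *)
Lemma Re_moebius_gt0 {R : realType} {a : R} {s : R[i]} :
  0 < a -> 0 <= complex.Re s ->
  0 < complex.Re ((s + real_complex R a) / (real_complex R a * s + 1)).
Proof.
move=> a_gt0 s_ge0; have den0 := moebius_den_neq0 a_gt0 s_ge0.
have := divfK den0 (s + real_complex R a); move: (_ / _) => [p q] /=.
case: s s_ge0 {den0} => u v /= u_ge0; simpc => -[re im].
have E : p * ((a * u + 1) ^+ 2 + (a * v) ^+ 2)
         = (u + a) * (a * u + 1) + v * (a * v).
  by rewrite -re -[in RHS](congr2 *%R im (erefl (a * v))); ring.
have den_gt0 : 0 < (a * u + 1) ^+ 2 + (a * v) ^+ 2.
  by apply: ltr_wpDr; [apply: sqr_ge0 | rewrite exprn_gt0 //; nra].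
rewrite -(pmulr_lgt0 p den_gt0) E.
have : 0 <= v * (a * v) by rewrite mulrCA pmulr_rge0 // -expr2 sqr_ge0.
have : 0 < (u + a) * (a * u + 1) by rewrite mulr_gt0 //; nra.
by lra.
Qed.

Lemma stable_moebius {R : realType} {d : nat} {a c : R} {p : {poly R}} :
  0 < a -> c != 0 -> quasi_stable p -> (size p <= d.+1)%N ->
  stable (c *: moebius d a p).
Proof.
move=> a_gt0 c0 qp sp s /rootP sroot; rewrite ltNge; apply/negP => s_ge0.
have den0 := moebius_den_neq0 a_gt0 s_ge0.
move/eqP: sroot; rewrite map_polyZ hornerZ (horner_moebius sp den0) /=.
apply/negP; rewrite !mulf_neq0 ?expf_neq0 ?fmorph_eq0 //.
by apply: quasi_stable_neq0 => //; apply: Re_moebius_gt0.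
Qed.

(** Up to the factor [(a s + 1)^(d + 2)], the new closed loop at [s] is the old
    one at [m s], because [m] transforms the two quadratic factors into
    multiples of their counterparts for [delta']. *)
Lemma stable_closed_loop_moebius {R : realType} {d : nat} {a delta delta' : R}
    {x y : {poly R}} :
  0 < a ->
  delta' * (1 + a ^+ 2 - 2 * delta * a) = delta * (1 + a ^+ 2) - 2 * a ->
  quasi_stable (closed_loop delta x y) ->
  (size x <= d.+1)%N -> (size y <= d.+1)%N ->
  stable (closed_loop delta' ((1 + a ^+ 2 - 2 * delta * a) *: moebius d a x)
                             ((1 - a ^+ 2) *: moebius d a y)).
Proof.
move=> a_gt0 delta'E qz sx sy s /rootP sroot.
rewrite ltNge; apply/negP => s_ge0.
have den0 := moebius_den_neq0 a_gt0 s_ge0.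
have := quasi_stable_neq0 _ _ qz (Re_moebius_gt0 a_gt0 s_ge0).
move: sroot; rewrite !horner_map_closed_loop !map_polyZ !hornerZ.
rewrite !(horner_moebius _ den0) //=.
have /(congr1 (real_complex R)) := delta'E.
rewrite !(rmorphD, rmorphM, rmorphB, rmorphN, rmorph1, rmorphXn, rmorph_nat) /=.
move: (real_complex R a) (real_complex R delta) (real_complex R delta') den0.
move=> A D D' den0 DE.
have {}DE : D' * (1 + A ^+ 2 - 2 * D * A) = D * (1 + A ^+ 2) - 2 * A.
  exact: DE.
move: (_.[_]) (_.[_]) => Y X E /eqP; apply.
(* [E]: the new closed loop vanishes at [s]; the goal: so does the old one at
   the image of [s]. *)
apply: (mulfI (expf_neq0 d.+2 den0)); rewrite mulr0 -{}E.
have -> : (A * s + 1) ^+ d.+2 = (A * s + 1) ^+ d * (A * s + 1) ^+ 2.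
  by rewrite -exprD addn2.
transitivity ((A * s + 1) ^+ d * (((1 + A ^+ 2 - 2 * D * A) * (s ^+ 2 + 1)
     - 2 * (D * (1 + A ^+ 2) - 2 * A) * s) * X
     + (1 - A ^+ 2) * (s ^+ 2 - 1) * Y)).
  by field.
by rewrite -DE; ring.
Qed.

(** The parameter is [a = (1 - r) / (1 + r)], where the contraction ratio
    satisfies [(1 + delta') / (1 - delta') = r^2 (1 + delta) / (1 - delta)]. *)
Lemma exists_moebius {R : realType} (delta delta' : R) :
  -1 < delta' -> delta' < delta -> delta < 1 ->
  exists a : R, [/\ 0 < a, a < 1, 1 + a ^+ 2 - 2 * delta * a != 0 &
    delta' * (1 + a ^+ 2 - 2 * delta * a) = delta * (1 + a ^+ 2) - 2 * a].
Proof.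
move=> d'_gt d'_lt d_lt.
have den_gt0 : 0 < (1 + delta) * (1 - delta') by rewrite mulr_gt0; lra.
have num_gt0 : 0 < (1 + delta') * (1 - delta) by rewrite mulr_gt0; lra.
pose r := Num.sqrt ((1 + delta') * (1 - delta) / ((1 + delta) * (1 - delta'))).
have r_gt0 : 0 < r by rewrite sqrtr_gt0 divr_gt0.
have r2 : r ^+ 2 * ((1 + delta) * (1 - delta')) = (1 + delta') * (1 - delta).
  by rewrite sqr_sqrtr ?divfK ?gt_eqF // divr_ge0 // ltW.
have r_lt1 : r < 1.
  rewrite -sqrtr1 ltr_sqrt // ltr_pdivrMr // mul1r; lra.
have r1_neq0 : 1 + r != 0 by rewrite gt_eqF; lra.
exists ((1 - r) / (1 + r)); split.
- by rewrite divr_gt0; lra.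
- by rewrite ltr_pdivrMr; lra.
- rewrite gt_eqF //.
  set a := (1 - r) / (1 + r).
  have a_gt0 : 0 < a by rewrite divr_gt0; lra.
  have := sqr_ge0 (1 - a).
  have : 0 < (1 - delta) * a by rewrite mulr_gt0; lra.
  by rewrite expr2; nra.
apply: (mulfI (expf_neq0 2 r1_neq0)).
transitivity (2 * delta' * (1 - delta + r ^+ 2 * (1 + delta))); first by field.
transitivity (2 * (delta * (1 + r ^+ 2) - (1 - r ^+ 2))); last by field.
by move: r2; lra.
Qed.

Theorem theorem3p5 (R : realType) (delta : R) :
  (quasi_admissible delta ->
     forall delta' : R, delta' < delta -> admissible delta') /\
  (forall (n : nat) (x y : {poly R}),
     quasi_admissible_by delta x y ->
     (size x <= n.+1)%N -> (size y <= n.+1)%N ->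
     forall delta' : R, delta' < delta ->
       exists x' y' : {poly R},
         [/\ admissible_by delta' x' y',
             (size x' <= n.+1)%N & (size y' <= n.+1)%N]).
Proof.
suff bounded : forall (n : nat) (x y : {poly R}),
     quasi_admissible_by delta x y ->
     (size x <= n.+1)%N -> (size y <= n.+1)%N ->
     forall delta' : R, delta' < delta ->
       exists x' y' : {poly R},
         [/\ admissible_by delta' x' y',
             (size x' <= n.+1)%N & (size y' <= n.+1)%N].
  split=> // -[x [y qxy]] delta' d'_lt; have [_ _ syx _] := qxy.
  have [x' [y' [adm _ _]]] :=
    bounded (size x) x y qxy (leqnSn _) (leqW syx) delta' d'_lt.
  by exists x', y'.
move=> n x y [qx qy syx qz] sx _ delta' d'_lt.
have [d'_lt0|d'_ge0] := ltP delta' 0.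
  have adm := admissible_neg delta' d'_lt0; exists 1, (2^-1)%:P; split=> //.
    by rewrite size_poly1.
  by rewrite (leq_trans (size_polyC_leq1 _)).
have [|a [a_gt0 a_lt1 c0 delta'E]] :=
  exists_moebius delta delta' _ d'_lt (closed_loop_lt1 delta x y qy qz).
  by lra.
(* [x] is nonzero since it has no positive root. *)
have x_gt0 : (0 < size x)%N.
  rewrite size_poly_gt0; have := quasi_stable_neq0_real x 1 qx ltr01.
  by apply: contraNneq => ->; rewrite horner0.
pose d := (size x).-1; have sxd : (size x <= d.+1)%N by rewrite prednK.
have syd := leq_trans syx sxd.
have e0 : 1 - a ^+ 2 != 0 by rewrite gt_eqF // subr_gt0 expr_lt1 // ltW.
exists ((1 + a ^+ 2 - 2 * delta * a) *: moebius d a x).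
exists ((1 - a ^+ 2) *: moebius d a y).
rewrite /admissible_by !size_scale // !size_moebius // prednK //.
split=> //; split=> //; first exact: stable_moebius.
  exact: stable_moebius.
exact: stable_closed_loop_moebius.
Qed.
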